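(* For any integer $r\geq 4$ there exists $n_0$ (depending on $r$) such that for all integers $n\geq n_0$, $$\mathrm{exsat_p}(K_r,K_r[n])=(2n-1)\binom r2.$$
   Context: For a graph $H$ and $n\in\mathbb{N}$, $H[n]$ is the graph obtained from $H$ by replacing each vertex with an independent set (a part) of size $n$ and each edge with a complete bipartite graph between the corresponding parts. A copy of $H$ in $H[n]$ is partite if it has exactly one vertex in each part of $H[n]$. A spanning subgraph $G\subseteq H[n]$ is $(H,H[n])$-partite-extra-saturated if for every edge $uv\in E(H[n])\setminus E(G)$ the graph $G\cup uv$ has more partite copies of $H$ than $G$ ($G$ itself is allowed to contain partite copies of $H$). $\mathrm{exsat_p}(H,H[n])$ is the minimum of $e(G)$ over all $(H,H[n])$-partite-extra-saturated graphs $G$. *)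

(* Defs.v *)
(* Plain Mathematical Components. *)
From HB Require Import structures.
From mathcomp Require Import all_boot.
Set Implicit Arguments.
Unset Strict Implicit.
Unset Printing Implicit Defensive.

(* A finite simple graph with vertex type T, given by its set of edges, an edge
   being a two-element set of vertices. *)
Record graph (T : finType) := Graph {
  edges : {set {set T}};
  _ : [forall e in edges, #|e| == 2] }.

HB.instance Definition _ (T : finType) := [isSub for @edges T].
HB.instance Definition _ (T : finType) := [Finite of graph T by <:].

Lemma mkgraph_subproof (T : finType) (E : {set {set T}}) :
  [forall e in [set e in E | #|e| == 2], #|e| == 2].
Proof. by apply/forall_inP => e; rewrite inE => /andP[]. Qed.

(* Members of E that are not two-element sets are dropped. *)
Definition mkgraph (T : finType) (E : {set {set T}}) : graph T :=
  Graph (mkgraph_subproof E).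

Definition complete (r : nat) : graph 'I_r := mkgraph [set: {set 'I_r}].

(* H[n]; the part of the vertex v of H consists of the pairs (v, i). As
   [set x.1; y.1] is an edge of H only if x.1 != y.1, parts are independent. *)
Definition blowup (V : finType) (H : graph V) (n : nat) : graph (V * 'I_n)%type :=
  mkgraph [set [set p.1; p.2] | p : (V * 'I_n) * (V * 'I_n)
                              & [set p.1.1; p.2.1] \in edges H].

Lemma blowupE (V : finType) (H : graph V) (n : nat) (u v : V * 'I_n) :
  ([set u; v] \in edges (blowup H n)) = ([set u.1; v.1] \in edges H).
Proof.
have fstE (x y : V * 'I_n) : fst @: [set x; y] = [set x.1; y.1].
  by rewrite imsetU1 imset_set1.
rewrite inE; apply/andP/idP => [[/imsetP[p + uvE] _]|uvH].
  by rewrite inE -!fstE uvE.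
split; first by apply/imsetP; exists (u, v); rewrite ?inE.
have /forall_inP/(_ _ uvH) := valP H; rewrite !cards2.
by case: (u =P v) => // ->; rewrite eqxx.
Qed.

Definition part (V : finType) (n : nat) (v : V) : {set V * 'I_n} :=
  [set x | x.1 == v].

Definition add_edge (T : finType) (G : graph T) (u v : T) : graph T :=
  mkgraph ([set u; v] |: edges G).

(* Copies are counted as subgraphs (vertex set, edge set) of G that are
   isomorphic to H, not as embeddings of H. *)
Definition copies (V T : finType) (H : graph V) (G : graph T) :
    {set {set T} * {set {set T}}} :=
  [set C : {set T} * {set {set T}} | (C.2 \subset edges G) &&
     [exists f : {ffun V -> T}, [&& injectiveb f, C.1 == f @: [set: V]
        & C.2 == [set f @: (e : {set V}) | e in edges H]]]].

Definition partite_copies (V : finType) (H : graph V) (n : nat)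
    (G : graph (V * 'I_n)%type) :=
  [set C in copies H G | [forall v : V, #|C.1 :&: part n v| == 1]].

Definition partite_extra_saturated (V : finType) (H : graph V) (n : nat)
    (G : graph (V * 'I_n)%type) : bool :=
  (edges G \subset edges (blowup H n)) &&
  [forall u, forall v,
     ([set u; v] \in edges (blowup H n) :\: edges G) ==>
     (#|partite_copies H G| < #|partite_copies H (add_edge G u v)|)].

(* H[n] itself is always admissible, so the minimum is over a nonempty set and
   the starting point of the arg min is immaterial; see exsat_pP. *)
Definition exsat_p (V : finType) (H : graph V) (n : nat) : nat :=
  #|edges [arg min_(G < blowup H n | partite_extra_saturated H G) #|edges G|]|.

Lemma blowup_extra_saturated (V : finType) (H : graph V) (n : nat) :
  partite_extra_saturated H (blowup H n).
Proof.
rewrite /partite_extra_saturated subxx /=.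
by apply/forallP => u; apply/forallP => v; rewrite setDv inE.
Qed.

Lemma exsat_pP (V : finType) (H : graph V) (n : nat) :
  (exists2 G : graph (V * 'I_n)%type,
     partite_extra_saturated H G & exsat_p H n = #|edges G|) /\
  (forall G : graph (V * 'I_n)%type,
     partite_extra_saturated H G -> exsat_p H n <= #|edges G|).
Proof.
rewrite /exsat_p; case: arg_minnP => [|G satG minG].
  exact: blowup_extra_saturated.
by split; first by exists G.
Qed.

(* Main.v *)
Require Import Defs.
From mathcomp Require Import all_boot.
From mathcomp Require Import zify.
Set Implicit Arguments.
Unset Strict Implicit.
Unset Printing Implicit Defensive.

(** The extremal graph picks one vertex in each part and joins it to every vertex
of the other parts.  Between two parts this is a double star with [2n - 1] edges,
and the chosen vertices complete any missing edge to a copy of [K_r].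

For the lower bound, saturation says that a missing edge [uv] extends to a
transversal of the parts all of whose other pairs are edges.  Two consequences
are played against each other.

- If [u] is not adjacent to a vertex [x] of part [j], then [x] has a neighbour
  inside the neighbourhood of [u] in every part [k] other than [j] and that of
  [u].  When [u] has bounded degree, this already forces [2n - O(1)] edges
  between parts [j] and [k], and more if many vertices of part [j] have other
  than one neighbour in part [k] ([pair_size_lower]).
- If [u] has exactly one neighbour [w k] in each part [k] other than its own,
  the [w k] are the only candidates for the transversal.  Since [r >= 4] they
  turn out to form a clique and to dominate each other's parts, which gives the
  exact bound [2n - 1] between any two parts not containing [u]
  ([pair_size_hub]).

If all vertices of some part have large degree, there are enough edges.  If not,
the first consequence applies to all pairs of parts.  Either some part has no
vertex as in the second consequence, and then its [n] vertices contribute an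
excess that outweighs the [O(1)] losses for large [n]; or every part has such a
vertex, and the second consequence applies to all pairs, as a third part is always
available ([sum_adj_lower]).

Edges are counted by ordered pairs throughout, so that all totals are twice the
number of edges. *)

(** * Adjacency and ordered pairs *)

Definition adj (T : finType) (G : graph T) : rel T :=
  fun u v => [set u; v] \in edges G.

Lemma adjC (T : finType) (G : graph T) : symmetric (adj G).
Proof. by move=> u v; rewrite /adj setUC. Qed.

Lemma handshake (T : finType) (G : graph T) :
  \sum_u \sum_v adj G u v = 2 * #|edges G|.
Proof.
rewrite pair_big /= -big_mkcond /=.
rewrite (partition_big (fun p : T * T => [set p.1; p.2]) [in edges G]) //=.
rewrite mulnC -sum_nat_const; apply: eq_bigr => e eG.
have /forall_inP/(_ e eG)/cards2P[a [b [ab eE]]] := valP G.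
have <- : #|[set (a, b); (b, a)]| = 2 by rewrite cards2 xpair_eqE negb_and ab.
rewrite -sum1_card; apply: eq_bigl => -[x y]; rewrite !inE /= /adj.
apply/andP/idP => [[_ /eqP xy]|].
  have xe : x \in e by rewrite -xy set21.
  have ye : y \in e by rewrite -xy set22.
  have xDy : x != y.
    by have := cards2 x y; rewrite xy eE cards2 ab; case: (x != y).
  move: xDy xe ye; rewrite eE !inE !xpair_eqE.
  by move=> + /orP[]/eqP xE /orP[]/eqP yE; rewrite xE yE ?eqxx ?orbT.
by rewrite !xpair_eqE => /orP[]/andP[/eqP-> /eqP->]; rewrite ?[[set b; a]]setUC -eE.
Qed.

(** * Saturation in terms of transversals *)

(** The transversal [k |-> (k, f k)] runs through [u] and [v], and all its pairs
except possibly [uv] are adjacent.  Constraining only [l] loses nothing for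
symmetric [e], since a pair other than [uv] has an element outside [{u, v}]. *)
Definition completion (r n : nat) (e : rel ('I_r * 'I_n)) (u v : 'I_r * 'I_n)
    (f : 'I_r -> 'I_n) : Prop :=
  [/\ f u.1 = u.2, f v.1 = v.2
    & forall k l, k != l -> l != u.1 -> l != v.1 -> e (k, f k) (l, f l)].

(** A copy comes with an embedding whose [k]-th vertex may lie in any part.  As it
meets every part once, the embedding can be precomposed with a permutation [h] of
the indices that puts the [k]-th vertex in part [k]; [K_r] is invariant under it. *)
Lemma partite_copy_transversal (r n : nat) (G : graph ('I_r * 'I_n)%type) C :
  C \in partite_copies (complete r) G ->
  exists f : 'I_r -> 'I_n, C.2 =
    [set [set (p.1, f p.1); (p.2, f p.2)] | p : 'I_r * 'I_r & p.1 != p.2].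
Proof.
rewrite !inE => /andP[/andP[_ /existsP[g /and3P[_ /eqP C1 /eqP C2]]]].
move=> /forallP Cpart.
have gsurj v : exists k, (g k).1 == v.
  have /cards1P[x xE] := Cpart v.
  have: x \in C.1 :&: part n v by rewrite xE set11.
  by rewrite C1 !inE => /andP[/imsetP[k _ ->]]; exists k.
pose h v := xchoose (gsurj v); pose f v := (g (h v)).2.
have gh v : g (h v) = (v, f v).
  by rewrite [LHS]surjective_pairing (eqP (xchooseP (gsurj v))).
have hinj : injective h by move=> v w /(congr1 g); rewrite !gh => -[].
have [h' h'K hK] := injF_bij hinj.
exists f; rewrite C2; apply/setP => x; apply/imsetP/imsetP => -[].
  move=> s; rewrite !inE => /cards2P[a [b [ab ->]]] ->.
  exists (h' a, h' b); rewrite ?inE /= ?(can_eq hK) //.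
  by rewrite -!gh !hK imsetU1 imset_set1.
move=> [k l]; rewrite inE /= => kl ->; exists [set h k; h l].
  by rewrite !inE cards2 (inj_eq hinj) kl.
by rewrite imsetU1 imset_set1 !gh.
Qed.

Lemma transversal_partite_copy (r n : nat) (G : graph ('I_r * 'I_n)%type)
    (f : 'I_r -> 'I_n) :
  (forall k l, k != l -> adj G (k, f k) (l, f l)) ->
  exists2 C, C \in partite_copies (complete r) G &
    forall k l, k != l -> [set (k, f k); (l, f l)] \in C.2.
Proof.
move=> fG; pose g := [ffun k : 'I_r => (k, f k)].
exists (g @: [set: 'I_r], [set g @: (e : {set 'I_r}) | e in edges (complete r)]).
  rewrite !inE; apply/andP; split; first (apply/andP; split).
  - apply/subsetP => e /imsetP[s]; rewrite !inE => /cards2P[a [b [ab ->]]] ->.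
    by rewrite imsetU1 imset_set1 !ffunE; apply: fG.
  - apply/existsP; exists g; rewrite !eqxx !andbT.
    by apply/injectiveP => k l; rewrite !ffunE => -[].
  apply/forallP => v; apply/cards1P; exists (v, f v); apply/setP => x.
  rewrite !inE /=; apply/andP/eqP => [[/imsetP[k _ ->]]|->].
    by rewrite ffunE /= => /eqP->.
  by split=> //; apply/imsetP; exists v; rewrite ?inE ?ffunE.
move=> k l kl; apply/imsetP; exists [set k; l]; first by rewrite !inE cards2 kl.
by rewrite imsetU1 imset_set1 !ffunE.
Qed.

Lemma adj_add_edge (T : finType) (G : graph T) (u v x y : T) : u != v ->
  adj (add_edge G u v) x y = ([set x; y] == [set u; v]) || adj G x y.
Proof.
move=> uv; rewrite /adj !inE; case: eqP => [->|_] /=; first by rewrite cards2 uv.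
by case xyG: (_ \in _) => //=; have /forall_inP/(_ _ xyG) := valP G.
Qed.

(** Copies of [G] survive in [add_edge G u v], so the number of copies grows exactly
when there is a copy that uses the edge [uv], that is, a transversal
through [u] and [v]. *)
Lemma partite_extra_saturatedP (r n : nat) (G : graph ('I_r * 'I_n)%type) :
  reflect
    (edges G \subset edges (blowup (complete r) n) /\
     forall u v, u.1 != v.1 -> ~~ adj G u v ->
       exists f, completion (adj G) u v f)
    (partite_extra_saturated (complete r) G).
Proof.
have blowE u v : ([set u; v] \in edges (blowup (complete r) n)) = (u.1 != v.1).
  by rewrite blowupE !inE cards2; case: (u.1 == v.1).
apply: (iffP andP) => -[Gsub Gsat]; split=> //.
  move=> u v uv1 uvG; have uv : u != v by apply: contraNneq uv1 => ->.
  have /forallP/(_ u)/forallP/(_ v) := Gsat.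
  rewrite inE blowE uv1 [_ \notin _]uvG => /= lt_copies.
  have /subsetPn[C CGuv CG] : ~~ (partite_copies (complete r) (add_edge G u v)
      \subset partite_copies (complete r) G).
    by apply: contraL lt_copies => /subset_leq_card; rewrite -leqNgt.
  have [f C2] := partite_copy_transversal CGuv.
  have Cadj k l : k != l -> adj (add_edge G u v) (k, f k) (l, f l).
    move: CGuv; rewrite !inE => /andP[/andP[/subsetP Csub _] _] kl.
    by apply: Csub; rewrite C2; apply/imsetP; exists (k, l); rewrite ?inE.
  (* The edge of C missing from G can only be uv, so C passes through u and v. *)
  have /subsetPn[x xC xG] : ~~ (C.2 \subset edges G).
    by move: CGuv CG; rewrite !inE => /andP[/andP[_ ->] ->]; rewrite !andbT.
  move: xC; rewrite C2 => /imsetP[[p q]]; rewrite inE /= => pq xE.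
  have := Cadj _ _ pq; rewrite adj_add_edge // /adj -xE (negbTE xG) orbF => /eqP xuv.
  have fP w : w \in x -> f w.1 = w.2.
    by rewrite xE !inE => /orP[] /eqP->.
  exists f; split; try by apply: fP; rewrite xuv !inE eqxx ?orbT.
  move=> k l kl lu lv; have := Cadj _ _ kl; rewrite adj_add_edge //.
  case/orP=> // /eqP kluv.
  have: (l, f l) \in [set u; v] by rewrite -kluv !inE eqxx orbT.
  by rewrite !inE => /orP[] /eqP E; move: lu lv; rewrite -E /= eqxx.
apply/forallP => u; apply/forallP => v; apply/implyP.
rewrite inE blowE => /andP[uvG uv1].
have uv : u != v by apply: contraNneq uv1 => ->.
have [f [fu fv fG]] := Gsat _ _ uv1 uvG.
have uE : (u.1, f u.1) = u by rewrite fu -surjective_pairing.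
have vE : (v.1, f v.1) = v by rewrite fv -surjective_pairing.
have fGuv k l : k != l -> adj (add_edge G u v) (k, f k) (l, f l).
  move=> kl; rewrite adj_add_edge //.
  have [lu|lu] := eqVneq l u.1; have [ku|ku] := eqVneq k u.1.
  - by rewrite lu ku eqxx in kl.
  - have [->|kv] := eqVneq k v.1; first by rewrite lu uE vE setUC eqxx.
    by rewrite adjC fG ?orbT // eq_sym.
  - have [->|lv] := eqVneq l v.1; first by rewrite ku uE vE eqxx.
    by rewrite fG ?orbT.
  have [lv|lv] := eqVneq l v.1; last by rewrite fG ?orbT.
  have [kv|kv] := eqVneq k v.1; first by rewrite lv kv eqxx in kl.
  by rewrite adjC fG ?orbT // eq_sym.
have [C Cnew CE] := transversal_partite_copy fGuv.
apply: proper_card; apply/properP; split.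
  apply/subsetP => C'; rewrite !inE => /andP[/andP[Csub ->] ->]; rewrite !andbT.
  apply: (subset_trans Csub); apply/subsetP => x xG; rewrite !inE xG orbT /=.
  by have /forall_inP/(_ _ xG) := valP G.
exists C => //; apply: contra uvG; rewrite !inE => /andP[/andP[/subsetP Csub _] _].
by apply: Csub; have := CE _ _ uv1; rewrite uE vE.
Qed.

(** * Counting edges between two parts *)

Definition deg_to (r n : nat) (e : rel ('I_r * 'I_n)) u (k : 'I_r) : nat :=
  \sum_y e u (k, y).

Definition pair_size (r n : nat) (e : rel ('I_r * 'I_n)) (j k : 'I_r) : nat :=
  \sum_x deg_to e (j, x) k.

(** The double star, which is extremal between two parts. *)
Lemma cross_size (n : nat) (a b : 'I_n) :
  \sum_(x < n) \sum_(y < n) ((x == a) || (y == b)) = 2 * n - 1.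
Proof.
rewrite (bigD1 a) //= (eq_bigr (fun=> 1)) => [|y _]; last by rewrite eqxx.
rewrite sum1_card card_ord.
rewrite (eq_bigr (fun=> 1)) => [|x xa]; last first.
  rewrite (bigD1 b) //= eqxx orbT big1 // => y yb.
  by rewrite (negbTE xa) (negbTE yb).
rewrite sum1_card cardC1 card_ord; have := ltn_ord a; lia.
Qed.

Lemma off_diagonal_sum (r c : nat) :
  \sum_(j < r) \sum_(k < r | k != j) c = r * (r - 1) * c.
Proof.
rewrite (eq_bigr (fun=> (r - 1) * c)) => [|j _]; last first.
  by rewrite sum_nat_const cardC1 card_ord subn1.
by rewrite sum_nat_const card_ord mulnA.
Qed.

Lemma sum_adjE (r n : nat) (e : rel ('I_r * 'I_n)) :
  \sum_u \sum_v e u v = \sum_j \sum_k pair_size e j k.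
Proof.
have pairE (F : 'I_r * 'I_n -> nat) : \sum_u F u = \sum_j \sum_x F (j, x).
  by rewrite pair_bigA; apply: eq_bigr => -[j x].
rewrite pairE; apply: eq_bigr => j _; rewrite /pair_size [RHS]exchange_big.
by apply: eq_bigr => x _; rewrite pairE.
Qed.

(** * The lower bound *)

(** Let [A] and [B] be the neighbourhoods of [u] in parts [j] and [k].  A vertex of
part [j] outside [A] has a neighbour in [B], and a vertex of part [k] outside [B]
has a neighbour in [A].  The edges found this way are distinct, as the former
avoid [A] and the latter meet it; each vertex outside [A] with at least two
neighbours in part [k] gives one more. *)
Lemma pair_size_lower (r n : nat) (e : rel ('I_r * 'I_n)) :
  symmetric e ->
  (forall u v, u.1 != v.1 -> ~~ e u v -> exists f, completion e u v f) ->
  forall (u : 'I_r * 'I_n) j k, j != u.1 -> k != u.1 -> k != j ->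
  2 * n + \sum_x (deg_to e (j, x) k != 1)
    <= pair_size e j k + 2 * deg_to e u j + deg_to e u k.
Proof.
move=> esym sat.
have hit u j k x : j != u.1 -> k != u.1 -> k != j -> ~~ e u (j, x) ->
    exists2 y, e u (k, y) & e (j, x) (k, y).
  move=> ju ku kj /sat[|f [fu /= fx fP]]; first by rewrite eq_sym.
  exists (f k); first by move: (fP u.1 k); rewrite fu -surjective_pairing eq_sym; apply.
  by rewrite -fx fP // eq_sym.
move=> u j k ju ku kj.
have splitE (F : 'I_n -> nat) i :
    \sum_x F x = \sum_(x | e u (i, x)) F x + \sum_(x | ~~ e u (i, x)) F x.
  exact: (bigID (fun x => e u (i, x))).
have dE i : deg_to e u i = \sum_(x | e u (i, x)) 1.
  by rewrite /deg_to [RHS]big_mkcond; apply: eq_bigr => x _; case: (e _ _).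
have nE i : n = deg_to e u i + \sum_(x | ~~ e u (i, x)) 1.
  by rewrite dE -splitE sum1_card card_ord.
(* Edges leaving A, counted from their ends outside B. *)
have into : \sum_(y | ~~ e u (k, y)) 1 <= \sum_(x | e u (j, x)) deg_to e (j, x) k.
  rewrite /deg_to exchange_big /= [leqRHS](splitE _ k).
  apply: leq_trans (leq_addl _ _); apply: leq_sum => y uy.
  have [x ux yx] : exists2 x, e u (j, x) & e (k, y) (j, x).
    by apply: hit uy => //; rewrite eq_sym.
  by rewrite (bigD1 x) //= esym yx.
(* Edges avoiding A; every vertex x outside A has degree at least 1. *)
have out : \sum_(x | ~~ e u (j, x)) 1
    + \sum_(x | ~~ e u (j, x)) (deg_to e (j, x) k != 1)
    <= \sum_(x | ~~ e u (j, x)) deg_to e (j, x) k.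
  rewrite -big_split; apply: leq_sum => x ux.
  have [y _ xy] := hit u j k x ju ku kj ux.
  have: 0 < deg_to e (j, x) k by rewrite /deg_to (bigD1 y) //= xy.
  by case: (deg_to e (j, x) k) => [|[|d]].
have few : \sum_(x | e u (j, x)) (deg_to e (j, x) k != 1) <= deg_to e u j.
  by rewrite dE; apply: leq_sum => x _; case: (_ != _).
have arith d d' c c' p q s t : n = d + c -> n = d' + c' -> c' <= p ->
    c + t <= q -> s <= d -> 2 * n + (s + t) <= p + q + 2 * d + d'.
  lia.
by rewrite /pair_size !(splitE _ j); apply: arith (nE j) (nE k) into out few.
Qed.

(** For a vertex [y] of part [j] other than [w j], the transversal completing [u] and
[y] must consist of the [w k] in the remaining parts.  Hence [y] is adjacent to
those [w k], and they are adjacent to each other.  To see that [w j] and [w k] are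
adjacent, start from a vertex [y] of a fourth part [l]; this needs [r >= 4]. *)
Lemma pair_size_hub (r n : nat) (e : rel ('I_r * 'I_n)) :
  3 < r -> 1 < n -> symmetric e ->
  (forall u v, u.1 != v.1 -> ~~ e u v -> exists f, completion e u v f) ->
  forall u : 'I_r * 'I_n, (forall k, k != u.1 -> deg_to e u k = 1) ->
  forall j k, j != u.1 -> k != u.1 -> k != j -> 2 * n - 1 <= pair_size e j k.
Proof.
move=> r_gt3 n_gt1 esym sat u deg1.
(* The implication makes the choice of w k possible in the part of u as well. *)
have wP k : exists w, (k != u.1) ==> [forall y, e u (k, y) == (y == w)].
  have [->|ku] /= := eqVneq k u.1; first by exists u.2.
  have /eqP/sum_nat_eq1[w [_ w1 w0]] := deg1 k ku; exists w; apply/forallP => y.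
  have [->|yw] := eqVneq y w; first by move: w1; case: (e _ _).
  by have := w0 y yw isT; case: (e _ _).
pose w k := xchoose (wP k).
have wE k y : k != u.1 -> e u (k, y) = (y == w k).
  by move=> ku; have /implyP/(_ ku)/forallP/(_ y)/eqP := xchooseP (wP k).
have wf j y : j != u.1 -> y != w j -> exists2 f, f j = y &
    (forall k, k != u.1 -> k != j -> f k = w k) /\
    forall k l, k != l -> l != u.1 -> l != j -> e (k, f k) (l, f l).
  move=> ju yw; have [||f [/= fu fj fP]] := sat u (j, y); rewrite ?wE // 1?eq_sym //.
  exists f => //; split=> // k ku kj; apply/eqP; rewrite -wE //.
  by move: (fP u.1 k); rewrite fu -surjective_pairing eq_sym; apply.
(* Completing u with a vertex of a part l other than j and k forces this edge. *)
have ww j k : j != u.1 -> k != u.1 -> k != j -> e (j, w j) (k, w k).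
  move=> ju ku kj.
  have [l lP] : exists l, l \notin [:: u.1; j; k].
    apply/existsP; apply: contraTT r_gt3; rewrite negb_exists => /forallP all_in.
    rewrite -leqNgt -[r]card_ord; apply: leq_trans (card_size [:: u.1; j; k]).
    by apply/subset_leq_card/subsetP => l _; have := all_in l; rewrite negbK.
  move: lP; rewrite !inE !negb_or => /and3P[lu].
  rewrite ![l == _]eq_sym => jl kl.
  have [y yw] : exists y, y != w l.
    apply/existsP; apply: contraTT n_gt1; rewrite negb_exists => /forallP all_w.
    rewrite -leqNgt -[n]card_ord -(card1 (w l)).
    by apply/subset_leq_card/subsetP => y _; have := all_w y; rewrite negbK.
  have [f _ [fw fP]] := wf l y lu yw.
  by rewrite -(fw j) // -(fw k) // fP // eq_sym.
have yw j k y : j != u.1 -> k != u.1 -> k != j -> e (j, y) (k, w k).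
  move=> ju ku kj; have [->|yw] := eqVneq y (w j); first exact: ww.
  have [f fj [fw fP]] := wf j y ju yw.
  by rewrite -fj -fw // fP // eq_sym.
move=> j k ju ku kj; rewrite -(cross_size (w j) (w k)).
apply: leq_sum => x _; apply: leq_sum => y _.
have [->|_] /= := eqVneq x (w j); first by rewrite esym yw // eq_sym.
by have [->|_] := eqVneq y (w k); first by rewrite yw.
Qed.

(** With [m = r (r - 1)] and the degree threshold [D = 2 m], each of the [m] ordered
pairs of parts loses at most [3 D = 6 m] in [pair_size_lower], a total of [6 m ^ 2],
which [n] compensates. *)
Lemma sum_adj_lower (r n : nat) (e : rel ('I_r * 'I_n)) :
  3 < r -> 1 < n -> 6 * (r * (r - 1)) ^ 2 <= n -> symmetric e ->
  (forall u v, u.1 != v.1 -> ~~ e u v -> exists f, completion e u v f) ->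
  r * (r - 1) * (2 * n - 1) <= \sum_j \sum_k pair_size e j k.
Proof.
move=> r_gt3 n_gt1 n_big esym sat; set m := r * (r - 1) in n_big *.
have offdiag (F : 'I_r -> 'I_r -> nat) :
    \sum_j \sum_(k | k != j) F j k <= \sum_j \sum_k F j k.
  by apply: leq_sum => j _; rewrite [leqRHS](bigID (fun k => k != j)) leq_addr.
have weaken s : m * (2 * n) <= s -> m * (2 * n - 1) <= s.
  by apply: leq_trans; rewrite leq_mul2l leq_subr orbT.
have third j k : k != j -> exists i : 'I_r, (j != i) && (k != i).
  move=> kj; apply/existsP; apply: contraTT r_gt3.
  rewrite negb_exists -leqNgt => /forallP all_in.
  apply: leq_trans (isT : 2 <= 3); rewrite -[r]card_ord.
  apply: leq_trans (card_size [:: j; k]); apply/subset_leq_card/subsetP => l _.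
  by have := all_in l; rewrite !inE negb_and !negbK ![l == _]eq_sym.
pose D := 2 * m.
(* Case 1: part i alone sends out n * D = m * (2 * n) edges. *)
have [/existsP[i /forallP high]|] :=
    boolP [exists i, forall x, D <= \sum_k deg_to e (i, x) k].
  apply: weaken; rewrite (bigD1 i) //= exchange_big /=.
  apply: leq_trans (leq_addr _ _).
  apply: (@leq_trans (\sum_(x < n) D)); last exact: leq_sum.
  by rewrite sum_nat_const card_ord /D; lia.
rewrite negb_exists => /forallP low.
(* Any low-degree vertex in a third part controls the pair (j, k). *)
have deficit j k : k != j ->
    2 * n + \sum_x (deg_to e (j, x) k != 1) <= pair_size e j k + 3 * D.
  move=> kj; have [i /andP[ji ki]] := third j k kj.
  have := low i; rewrite negb_forall => /existsP[x]; rewrite -ltnNge => degD.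
  have deg_le l : deg_to e (i, x) l <= D.
    by apply: leq_trans (ltnW degD); rewrite (bigD1 l) //= leq_addr.
  have := pair_size_lower esym sat (u := (i, x)) ji ki kj.
  by have := deg_le j; have := deg_le k; lia.
(* Case 2: each vertex of part i has a degree other than 1 into some part, which
   adds n to the bound summed over all pairs. *)
have [/existsP[i /forallP nohub]|] :=
    boolP [exists i, forall x, exists k, (k != i) && (deg_to e (i, x) k != 1)].
  apply: weaken; apply: leq_trans (offdiag _).
  have: \sum_j \sum_(k | k != j) (2 * n + \sum_x (deg_to e (j, x) k != 1))
      <= \sum_j \sum_(k | k != j) (pair_size e j k + 3 * D).
    by apply: leq_sum => j _; apply: leq_sum => k; apply: deficit.
  under eq_bigr do rewrite big_split /=.
  under [X in _ <= X]eq_bigr do rewrite big_split /=.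
  rewrite !big_split /= !off_diagonal_sum -/m.
  have: n <= \sum_j \sum_(k | k != j) \sum_x (deg_to e (j, x) k != 1).
    rewrite (bigD1 i) //= exchange_big /=; apply: leq_trans (leq_addr _ _).
    rewrite -[leqLHS]card_ord -sum1_card; apply: leq_sum => x _.
    have /existsP[k /andP[ki dk]] := nohub x.
    by rewrite (bigD1 k) //= dk.
  have arith s t : n <= t -> m * (2 * n) + t <= s + m * (3 * D) -> m * (2 * n) <= s.
    by move: n_big; rewrite /D; lia.
  exact: arith.
(* Case 3: every part contains a vertex with one neighbour in each other part. *)
rewrite negb_exists => /forallP hubs.
apply: leq_trans (offdiag _); rewrite -off_diagonal_sum.
apply: leq_sum => j _; apply: leq_sum => k kj.
have [i /andP[ji ki]] := third j k kj.
have := hubs i; rewrite negb_forall => /existsP[x]; rewrite negb_exists => /forallP xP.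
apply: (pair_size_hub r_gt3 n_gt1 esym sat (u := (i, x))) => // l li.
by have := xP l; rewrite li negbK => /eqP.
Qed.

(** * The extremal graph *)

Definition spokes (r n : nat) (o : 'I_n) : graph ('I_r * 'I_n)%type :=
  mkgraph [set s in edges (blowup (complete r) n) | [exists x in s, x.2 == o]].

Lemma adj_spokes (r n : nat) (o : 'I_n) (u v : 'I_r * 'I_n) :
  adj (spokes r o) u v = (u.1 != v.1) && ((u.2 == o) || (v.2 == o)).
Proof.
have -> : adj (spokes r o) u v = ([set u; v] \in edges (blowup (complete r) n))
    && [exists x in [set u; v], x.2 == o].
  rewrite /adj inE inE andbC; case uvE: (_ \in edges _) => /=; last by rewrite andbF.
  by have /forall_inP/(_ _ uvE)-> := valP (blowup (complete r) n).
rewrite blowupE !inE cards2; congr (_ && _); first by case: (u.1 == v.1).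
apply/exists_inP/orP => [[x]|[uo|vo]].
- by rewrite !inE => /orP[]/eqP->; auto.
- by exists u; rewrite ?inE ?eqxx.
by exists v; rewrite ?inE ?eqxx ?orbT.
Qed.

Lemma spokes_saturated (r n : nat) (o : 'I_n) :
  partite_extra_saturated (complete r) (spokes r o).
Proof.
apply/partite_extra_saturatedP; split.
  by apply/subsetP => s; rewrite !inE => /andP[/andP[->]].
move=> u v uv1 _.
exists (fun k => if k == u.1 then u.2 else if k == v.1 then v.2 else o).
split; rewrite ?eqxx //; first by rewrite eq_sym (negbTE uv1).
move=> k l kl lu lv; rewrite adj_spokes /= kl (negbTE lu) (negbTE lv) eqxx.
by rewrite orbT.
Qed.

Lemma spokes_size (r n : nat) (o : 'I_n) :
  2 * #|edges (spokes r o)| = r * (r - 1) * (2 * n - 1).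
Proof.
rewrite -handshake sum_adjE -off_diagonal_sum; apply: eq_bigr => j _.
rewrite (bigID (fun k => k != j)) /= [X in _ + X]big1 => [|k].
  rewrite addn0; apply: eq_bigr => k kj; rewrite -(cross_size o o).
  apply: eq_bigr => x _; apply: eq_bigr => y _.
  by rewrite adj_spokes /= eq_sym kj.
rewrite negbK => /eqP->; rewrite /pair_size big1 // => x _.
by rewrite /deg_to big1 // => y _; rewrite adj_spokes eqxx.
Qed.

(** * The extremal number *)

Theorem theorem13 (r : nat) (hr : 4 <= r) :
  exists n0 : nat, forall n : nat, n0 <= n ->
    exsat_p (complete r) n = (2 * n - 1) * 'C(r, 2).
Proof.
exists (6 * (r * (r - 1)) ^ 2) => n n_big.
have n_gt1 : 1 < n by apply: leq_trans n_big; nia.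
have binE : r * (r - 1) * (2 * n - 1) = 2 * ((2 * n - 1) * 'C(r, 2)).
  by rewrite [r - 1]subn1 -[r.-1]ffactn1 -ffactnS -bin_ffact mulnC mulnA mulnC.
pose o := Ordinal (ltnW n_gt1).
have [[G /partite_extra_saturatedP[_ Gsat] ->] minimal] := exsat_pP (complete r) n.
apply/eqP; rewrite -(eqn_pmul2l (isT : 0 < 2)) -binE eqn_leq.
rewrite -(spokes_size r o) leq_pmul2l // minimal ?spokes_saturated //= spokes_size.
rewrite -handshake sum_adjE.
exact: sum_adj_lower hr n_gt1 n_big (@adjC _ G) Gsat.
Qed.
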